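(* Let $g:S^1\to X$ be a continuous surjection onto a Peano continuum $X$. The following are equivalent: (a) $g$ is arcwise increasing; (b) $g$ is hereditarily irreducible; (c) $g$ is strongly irreducible; (d) $g$ is almost injective; (e) $g$ is irreducible. If moreover $X$ is a Peano graph, these are also equivalent to: (f) $g$ is edge-wise Eulerian and $g^{-1}(\operatorname{Gr}(X))$ is zero-dimensional.
   Context: For a continuous map $g:X\to Y$ between continua: $g$ is almost injective if $\{x: g^{-1}(g(x))=\{x\}\}$ is dense in $X$; irreducible if $g(K)\subsetneq g(X)$ for every proper subcontinuum $K\subsetneq X$; hereditarily irreducible if $g(A)\subsetneq g(B)$ for all subcontinua $A\subsetneq B$; strongly irreducible if $g(A)\subsetneq g(X)$ for every closed $A\subsetneq X$; arcwise increasing if $g(A)\subsetneq g(B)$ for all arcs $A\subsetneq B$. A Peano continuum is a compact connected locally connected metrizable space; a free arc (edge) is an inclusion-maximal open subset homeomorphic to $(0,1)$; $\operatorname{Gr}(X)$ is $X$ minus the union of all edges; a Peano graph is a Peano continuum in which the union of edges is dense. A continuous surjection $g:S^1\to X$ is edge-wise Eulerian if $g^{-1}(x)$ is a singleton for every $x$ lying in an edge. *)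

(* Defs.v *)
From Stdlib Require Import Reals List.
Open Scope R_scope.

Section Generic.
Context {T : Type} (d : T -> T -> R).

Definition is_metric : Prop :=
  (forall x y, 0 <= d x y) /\ (forall x y, d x y = 0 <-> x = y) /\
  (forall x y, d x y = d y x) /\ (forall x y z, d x z <= d x y + d y z).

Definition open (U : T -> Prop) : Prop :=
  forall x, U x -> exists r, 0 < r /\ forall y, d x y < r -> U y.

Definition closed (A : T -> Prop) : Prop := open (fun x => ~ A x).

Definition compact (A : T -> Prop) : Prop :=
  forall (I : Type) (U : I -> T -> Prop), (forall i, open (U i)) ->
    (forall x, A x -> exists i, U i x) ->
    exists l : list I, forall x, A x -> exists i, In i l /\ U i x.

Definition connected (A : T -> Prop) : Prop :=
  ~ exists U V, open U /\ open V /\ (forall x, A x -> U x \/ V x) /\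
      (exists x, A x /\ U x) /\ (exists x, A x /\ V x) /\
      (forall x, A x -> U x -> V x -> False).

Definition continuum (A : T -> Prop) : Prop :=
  (exists x, A x) /\ compact A /\ connected A.

Definition locally_connected : Prop :=
  forall x U, open U -> U x ->
    exists V, open V /\ V x /\ (forall y, V y -> U y) /\ connected V.

Definition peano_continuum : Prop :=
  continuum (fun _ => True) /\ locally_connected.

Definition dense (D : T -> Prop) : Prop :=
  forall x r, 0 < r -> exists y, d x y < r /\ D y.

Definition homeomorphic_to_R (I : R -> Prop) (A : T -> Prop) : Prop :=
  exists (h : R -> T) (k : T -> R),
    (forall t, I t -> A (h t)) /\
    (forall x, A x -> I (k x) /\ h (k x) = x) /\
    (forall t, I t -> k (h t) = t) /\
    (forall t, I t -> forall eps, 0 < eps -> exists delta, 0 < delta /\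
        forall s, I s -> Rabs (s - t) < delta -> d (h t) (h s) < eps) /\
    (forall x, A x -> forall eps, 0 < eps -> exists delta, 0 < delta /\
        forall y, A y -> d x y < delta -> Rabs (k x - k y) < eps).

Definition arc (A : T -> Prop) : Prop :=
  homeomorphic_to_R (fun t => 0 <= t <= 1) A.

Definition edge (E : T -> Prop) : Prop :=
  open E /\ homeomorphic_to_R (fun t => 0 < t < 1) E /\
  forall E', open E' -> homeomorphic_to_R (fun t => 0 < t < 1) E' ->
    (forall x, E x -> E' x) -> forall x, E' x -> E x.

Definition in_edge (x : T) : Prop := exists E, edge E /\ E x.

Definition Gr (x : T) : Prop := ~ in_edge x.

Definition peano_graph : Prop := peano_continuum /\ dense in_edge.

Definition clopen_in (B C : T -> Prop) : Prop :=
  (forall c, C c -> exists delta, 0 < delta /\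
      forall y, B y -> d c y < delta -> C y) /\
  (forall b, B b -> ~ C b -> exists delta, 0 < delta /\
      forall y, B y -> d b y < delta -> ~ C y).

(* zero-dimensional (small inductive dimension <= 0): every point has
   arbitrarily small relatively clopen neighbourhoods *)
Definition zero_dimensional (B : T -> Prop) : Prop :=
  forall x, B x -> forall r, 0 < r -> exists C, C x /\
    (forall y, C y -> B y /\ d x y < r) /\ clopen_in B C.

End Generic.

Definition continuous {T U : Type} (dT : T -> T -> R) (dU : U -> U -> R)
  (f : T -> U) : Prop :=
  forall x eps, 0 < eps -> exists delta, 0 < delta /\
    forall y, dT x y < delta -> dU (f x) (f y) < eps.

Definition image {T U : Type} (f : T -> U) (A : T -> Prop) (y : U) : Prop :=
  exists x, A x /\ f x = y.

Definition preimage {T U : Type} (f : T -> U) (B : U -> Prop) (x : T) : Prop :=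
  B (f x).

Definition subset {T : Type} (A B : T -> Prop) : Prop := forall x, A x -> B x.
Definition proper_subset {T : Type} (A B : T -> Prop) : Prop :=
  subset A B /\ exists x, B x /\ ~ A x.

Definition S1 : Type := { p : R * R | fst p * fst p + snd p * snd p = 1 }.
Definition dS1 (p q : S1) : R :=
  sqrt ((fst (proj1_sig p) - fst (proj1_sig q)) ^ 2 +
        (snd (proj1_sig p) - snd (proj1_sig q)) ^ 2).

Section Maps.
Context {T U : Type} (dT : T -> T -> R) (dU : U -> U -> R) (g : T -> U).

Definition almost_injective : Prop :=
  dense dT (fun x => forall y, g y = g x -> y = x).

Definition irreducible : Prop :=
  forall K, continuum dT K -> proper_subset K (fun _ => True) ->
    proper_subset (image g K) (image g (fun _ => True)).

Definition hereditarily_irreducible : Prop :=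
  forall A B, continuum dT A -> continuum dT B -> proper_subset A B ->
    proper_subset (image g A) (image g B).

Definition strongly_irreducible : Prop :=
  forall A, closed dT A -> proper_subset A (fun _ => True) ->
    proper_subset (image g A) (image g (fun _ => True)).

Definition arcwise_increasing : Prop :=
  forall A B, arc dT A -> arc dT B -> proper_subset A B ->
    proper_subset (image g A) (image g B).

Definition edgewise_eulerian : Prop :=
  (forall y, exists x, g x = y) /\
  forall y, in_edge dU y -> exists x, forall x', g x' = y <-> x' = x.

End Maps.

(* Main.v *)
(* Write (a)-(f) for the six conditions in the order of the statement.

   (c) => (d): for a strongly irreducible map the complement of a ball has a
   proper closed image, so every ball contains a smaller one whose fibres stay
   in the first; nesting such balls gives a point with a singleton fibre.
   (d) => (b): if A is a proper subcontinuum of B, connectedness of B puts a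
   non-degenerate arc, hence a point with a singleton fibre, into B \ A.
   (b) => (a) and (b) => (e) are immediate, and (a) => (c), (e) => (c) hold
   because a proper closed subset of the circle lies in a proper arc, which is
   itself contained in a larger proper arc.

   For (f): if g(a) = g(b) lies in an edge and a <> b, then the two half-arcs
   at a and one half-arc at b are mapped to the edge by three paths from the
   same point. Two of them leave it on the same side, so an interval of values
   is taken twice, which contradicts (d). Finally, a subset of the circle is
   zero-dimensional iff its complement is dense. *)

From Stdlib Require Import Reals Lra List Lia Classical ClassicalEpsilon.
From Stdlib Require Import FunctionalExtensionality PropExtensionality.
Require Import Defs.
Open Scope R_scope.

(** * Closed, compact and connected sets in metric spaces *)

Section Metric.
Context {T : Type} (d : T -> T -> R) (Hd : is_metric d).

Lemma dist_self (x : T) : d x x = 0.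
Proof. destruct Hd as (_ & H & _). now apply H. Qed.

Lemma dist_sym (x y : T) : d x y = d y x.
Proof. apply Hd. Qed.

Lemma dist_triangle (x y z : T) : d x z <= d x y + d y z.
Proof. apply Hd. Qed.

Lemma dist_pos (x y : T) : x <> y -> 0 < d x y.
Proof.
  intros H. destruct Hd as (H0 & H1 & _).
  destruct (H0 x y) as [|E]; [assumption|].
  exfalso. apply H, H1. now symmetry.
Qed.

(** [compact] and [connected] quantify over open sets of the whole space, so a relatively open part
    of [A] is thickened to an ambient open set; off [A] nothing is claimed about [P]. *)
Definition relative_interior (A P : T -> Prop) (x : T) : Prop :=
  exists r, 0 < r /\ forall y, A y -> d x y < r -> P y.

Lemma open_relative_interior (A P : T -> Prop) :
  open d (relative_interior A P).
Proof.
  intros x (r & Hr & H). exists (r / 2). split; [lra|].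
  intros y Hy. exists (r / 2). split; [lra|].
  intros z Az Hz. apply H; [assumption|].
  pose proof (dist_triangle x y z). lra.
Qed.

Lemma relative_interior_sub (A P : T -> Prop) (x : T) :
  A x -> relative_interior A P x -> P x.
Proof.
  intros Ax (r & Hr & H). apply H; [assumption|]. now rewrite dist_self.
Qed.

Lemma open_dist_gt (x : T) (r : R) : open d (fun y => r < d x y).
Proof.
  intros y Hy. exists (d x y - r). split; [lra|]. intros z Hz.
  pose proof (dist_triangle x z y). rewrite (dist_sym z y) in *. lra.
Qed.

Lemma closed_ball_complement (x : T) (r : R) :
  closed d (fun y => ~ d x y < r).
Proof.
  intros y Hy. apply NNPP in Hy. exists (r - d x y). split; [lra|].
  intros z Hz C. apply C. pose proof (dist_triangle x y z). lra.
Qed.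

(** In an increasing cover the member with the largest index of a finite subcover contains the
    others. *)
Lemma compact_exhausted (A : T -> Prop) (U : nat -> T -> Prop) :
  compact d A -> (forall n, open d (U n)) ->
  (forall m n x, (m <= n)%nat -> U m x -> U n x) ->
  (forall x, A x -> exists n, U n x) -> exists n, forall x, A x -> U n x.
Proof.
  intros HA HU Hinc Hcov.
  destruct (HA nat U HU Hcov) as [l Hl]. exists (list_max l).
  intros x Ax. destruct (Hl x Ax) as (i & Hi & Ui).
  apply Hinc with i; [|assumption].
  pose proof (proj1 (list_max_le l (list_max l)) (le_n _)) as F.
  rewrite Forall_forall in F. now apply F.
Qed.

(** The sets of points farther than 1/(n+1) from [x] exhaust [A], so one of them contains [A] and a
    ball about [x] misses [A]. *)
Lemma compact_closed (A : T -> Prop) : compact d A -> closed d A.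
Proof.
  intros HA x Hx.
  destruct (compact_exhausted A (fun n y => / INR (S n) < d x y)) as [n Hn].
  - assumption.
  - intros n. apply open_dist_gt.
  - intros m n y Hmn. apply Rle_lt_trans.
    apply Rinv_le_contravar; [apply lt_0_INR; lia|apply le_INR; lia].
  - intros y Ay. assert (Hxy : 0 < d x y)
      by (apply dist_pos; intros E; now subst).
    destruct (archimed_cor1 _ Hxy) as (n & Hn & Hn0).
    exists (pred n). now replace (S (pred n)) with n by lia.
  - exists (/ INR (S n)). split.
    + apply Rinv_0_lt_compat, lt_0_INR. lia.
    + intros y Hy Ay. specialize (Hn y Ay). cbv beta in Hn. lra.
Qed.

Lemma closed_compact (A : T -> Prop) :
  compact d (fun _ => True) -> closed d A -> compact d A.
Proof.
  intros HT HA I U HU Hcov.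
  (* The index [None] stands for the complement of [A], which completes the cover of [A] to one of
     the space; [flat_map] drops it again. *)
  destruct (HT (option I) (fun o => match o with
    | Some i => U i | None => fun x => ~ A x end)) as [l Hl].
  - intros [i|]; [apply HU|apply HA].
  - intros x _. destruct (classic (A x)) as [Ax|Nx].
    + destruct (Hcov x Ax) as [i Hi]. now exists (Some i).
    + now exists None.
  - exists (flat_map (fun o => match o with
      | Some i => i :: nil | None => nil end) l).
    intros x Ax. destruct (Hl x Logic.I) as ([i|] & Hi & Ui).
    + exists i. split; [|assumption]. apply in_flat_map.
      exists (Some i). split; [assumption|now left].
    + contradiction.
Qed.

Lemma compact_union (A B C : T -> Prop) :
  compact d A -> compact d B -> (forall x, C x <-> A x \/ B x) -> compact d C.
Proof.
  intros HA HB E I U HU Hcov.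
  destruct (HA I U HU) as [l Hl]; [intros; apply Hcov, E; tauto|].
  destruct (HB I U HU) as [m Hm]; [intros; apply Hcov, E; tauto|].
  exists (l ++ m). intros x Cx. apply E in Cx.
  destruct Cx as [Ax|Bx];
    [destruct (Hl x Ax) as (i & ? & ?)|destruct (Hm x Bx) as (i & ? & ?)];
    exists i; (split; [apply in_or_app; tauto|assumption]).
Qed.

Lemma connected_union (A B C : T -> Prop) (z : T) :
  connected d A -> connected d B -> A z -> B z ->
  (forall x, C x <-> A x \/ B x) -> connected d C.
Proof.
  intros HA HB Az Bz E (U & V & HU & HV & Hcov & (u & Cu & Uu) & (v & Cv & Vv) & Hd0).
  (* A connected piece through [z] lies wholly on the side that contains [z]. *)
  assert (Hin : forall P : T -> Prop, (forall x, P x -> C x) -> connected d P ->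
    P z -> (U z -> forall x, P x -> U x) /\ (V z -> forall x, P x -> V x)).
  { intros P PC HP Pz. split; intros Hz x Px;
    destruct (Hcov x (PC x Px)) as [Ux|Vx]; try assumption;
    exfalso; apply HP; exists U, V; repeat split; auto; eauto. }
  destruct (Hin A) as [A1 A2]; [intros; apply E; tauto|assumption|assumption|].
  destruct (Hin B) as [B1 B2]; [intros; apply E; tauto|assumption|assumption|].
  assert (Cz : C z) by (apply E; tauto).
  destruct (Hcov z Cz) as [Uz|Vz].
  - apply (Hd0 v Cv); [|assumption]. apply E in Cv. destruct Cv; auto.
  - apply (Hd0 u Cu); [assumption|]. apply E in Cu. destruct Cu; auto.
Qed.

End Metric.

(** * Continuous images of compact and connected sets *)

Definition continuous_on {T U : Type} (dT : T -> T -> R) (dU : U -> U -> R)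
  (f : T -> U) (A : T -> Prop) : Prop :=
  forall x, A x -> forall eps, 0 < eps -> exists delta, 0 < delta /\
    forall y, A y -> dT x y < delta -> dU (f x) (f y) < eps.

Section Images.
Context {T U : Type} (dT : T -> T -> R) (dU : U -> U -> R).
Context (HT : is_metric dT) (HU : is_metric dU).
Context (f : T -> U) (A : T -> Prop) (Hf : continuous_on dT dU f A).

Lemma preimage_relative_interior (V : U -> Prop) (x : T) :
  open dU V -> A x -> V (f x) ->
  relative_interior dT A (fun y => V (f y)) x.
Proof.
  intros HV Ax Vx. destruct (HV _ Vx) as (r & Hr & H).
  destruct (Hf x Ax r Hr) as (e & He & H'). exists e. split; auto.
Qed.

Lemma compact_image : compact dT A -> compact dU (image f A).
Proof.
  intros HA I V HV Hcov.
  destruct (HA I (fun i => relative_interior dT A (fun y => V i (f y))))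
    as [l Hl].
  - intros i. now apply open_relative_interior.
  - intros x Ax. destruct (Hcov (f x)) as [i Hi]; [now exists x|].
    exists i. now apply preimage_relative_interior.
  - exists l. intros y (x & Ax & <-). destruct (Hl x Ax) as (i & Hi & Vi).
    exists i. split; [assumption|].
    exact (relative_interior_sub dT HT A (fun y => V i (f y)) x Ax Vi).
Qed.

Lemma connected_image : connected dT A -> connected dU (image f A).
Proof.
  intros HA (V & W & HV & HW & Hcov & (u & (x & Ax & <-) & Vx) &
    (v & (y & Ay & <-) & Wy) & Hdis).
  apply HA. exists (relative_interior dT A (fun y => V (f y))),
    (relative_interior dT A (fun y => W (f y))).
  split; [now apply open_relative_interior|].
  split; [now apply open_relative_interior|].
  split; [|split; [|split]].
  - intros z Az. destruct (Hcov (f z)); [now exists z|left|right];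
      now apply preimage_relative_interior.
  - exists x. split; [|apply preimage_relative_interior]; assumption.
  - exists y. split; [|apply preimage_relative_interior]; assumption.
  - intros z Az Vz Wz. apply (Hdis (f z)); [now exists z| |].
    + exact (relative_interior_sub dT HT A (fun y => V (f y)) z Az Vz).
    + exact (relative_interior_sub dT HT A (fun y => W (f y)) z Az Wz).
Qed.

Lemma continuum_image : continuum dT A -> continuum dU (image f A).
Proof.
  intros ((x & Ax) & HK & HC). split; [|split].
  - exists (f x). now exists x.
  - now apply compact_image.
  - now apply connected_image.
Qed.

End Images.

(** * Intervals of the real line *)

Lemma Rdist_metric : is_metric Rdist.
Proof.
  split; [|split; [|split]].
  - intros x y. apply Rge_le, Rdist_pos.
  - intros x y. apply Rdist_refl.
  - apply Rdist_sym.
  - intros x y z. apply Rdist_tri.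
Qed.

(* Cousin's lemma, for additive interval predicates. *)
Lemma interval_induction (a b : R) (Q : R -> R -> Prop) :
  a <= b ->
  (forall u v w, a <= u <= v -> v <= w <= b -> Q u v -> Q v w -> Q u w) ->
  (forall x, a <= x <= b -> exists e, 0 < e /\ forall u v,
     a <= u <= x -> x <= v <= b -> x - e < u -> v < x + e -> Q u v) ->
  Q a b.
Proof.
  intros Hab Hadd Hloc.
  assert (Qa : Q a a).
  { destruct (Hloc a) as (e & He & H); [lra|]. apply H; lra. }
  destruct (completeness (fun x => a <= x <= b /\ Q a x)) as [m [Hub Hlub]].
  - exists b. intros x [Hx _]. lra.
  - exists a. split; [lra|assumption].
  - assert (Ham : a <= m) by (apply Hub; split; [lra|assumption]).
    assert (Hmb : m <= b) by (apply Hlub; intros x [Hx _]; lra).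
    destruct (Hloc m) as (e & He & H); [lra|].
    assert (Hx : exists x, a <= x <= b /\ Q a x /\ m - e < x).
    { apply NNPP. intros C. assert (m <= m - e); [|lra].
      apply Hlub. intros x [Hx Qx]. apply Rnot_lt_le. intros Hlt. apply C.
      now exists x. }
    destruct Hx as (x & Hx & Qx & Hlt).
    assert (Hxm : x <= m) by (apply Hub; now split).
    (* Around the supremum [m] of the points reached from [a], the local hypothesis leads from [x]
       either to [b] or to m + e/2, which is beyond the supremum. *)
    destruct (Rle_lt_dec b (m + e / 2)) as [Hb|Hb].
    + apply Hadd with x; try lra; [assumption|]. apply H; lra.
    + assert (m + e / 2 <= m); [|lra]. apply Hub. split; [lra|].
      apply Hadd with x; try lra; [assumption|]. apply H; lra.
Qed.

(** Both properties come from [interval_induction]: finite subcovers of adjacent intervals can be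
    concatenated, and membership in one side of a separation is locally constant. *)
Lemma continuum_interval (a b : R) :
  a <= b -> continuum Rdist (fun t => a <= t <= b).
Proof.
  intros Hab. split; [|split].
  - exists a. lra.
  - intros I U HU Hcov.
    apply (interval_induction a b (fun u v => exists l : list I,
      forall x, u <= x <= v -> exists i, In i l /\ U i x)); [assumption| |].
    + intros u v w _ _ [l Hl] [m Hm]. exists (l ++ m). intros x Hx.
      destruct (Rle_lt_dec x v);
        [destruct (Hl x) as (i & ? & ?)|destruct (Hm x) as (i & ? & ?)];
        try lra; exists i; (split; [apply in_or_app; tauto|assumption]).
    + intros x Hx. destruct (Hcov x Hx) as [i Hi].
      destruct (HU i x Hi) as (r & Hr & H). exists r. split; [assumption|].
      intros u v Hu Hv Hu' Hv'. exists (i :: nil). intros y Hy. exists i.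
      split; [now left|]. apply H. unfold Rdist. apply Rabs_def1; lra.
  - intros (U & V & HU & HV & Hcov & (u & Hu & Uu) & (v & Hv & Vv) & Hdis).
    assert (Hconst : forall s t, a <= s <= t -> t <= b -> (U s <-> U t)).
    { intros s t Hs Ht.
      apply (interval_induction s t (fun x y => U x <-> U y)); [lra|tauto|].
      intros x Hx. destruct (Hcov x) as [Ux|Vx]; [lra| |].
      - destruct (HU x Ux) as (r & Hr & H). exists r. split; [assumption|].
        intros y z Hy Hz Hy' Hz'.
        split; intros _; apply H; unfold Rdist; apply Rabs_def1; lra.
      - destruct (HV x Vx) as (r & Hr & H). exists r. split; [assumption|].
        intros y z Hy Hz Hy' Hz'.
        split; intros Uy; exfalso; [apply (Hdis y)|apply (Hdis z)]; try lra;
          try assumption; apply H; unfold Rdist; apply Rabs_def1; lra. }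
    apply (Hdis v); try assumption.
    destruct (Rle_lt_dec u v).
    + apply (Hconst u v); [lra|lra|assumption].
    + apply (Hconst v u); [lra|lra|assumption].
Qed.

(** A skipped value would split the connected image into a part below it and a part above it. *)
Lemma intermediate_value (F : R -> R) (a b y : R) :
  a <= b -> continuous_on Rdist Rdist F (fun t => a <= t <= b) ->
  F a < y < F b -> exists t, a <= t <= b /\ F t = y.
Proof.
  intros Hab HF Hy.
  pose proof (connected_image _ _ Rdist_metric F _ HF
    (proj2 (proj2 (continuum_interval a b Hab)))) as HC.
  apply NNPP. intros C. apply HC.
  exists (fun t => t < y), (fun t => y < t). split; [|split; [|split; [|split; [|split]]]].
  - intros t Ht. exists (y - t). split; [lra|].
    intros s Hs. unfold Rdist in Hs. apply Rabs_def2 in Hs. lra.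
  - intros t Ht. exists (t - y). split; [lra|].
    intros s Hs. unfold Rdist in Hs. apply Rabs_def2 in Hs. lra.
  - intros z (t & Ht & <-). destruct (Rtotal_order (F t) y) as [|[E|]];
      [now left|exfalso; apply C; now exists t|now right].
  - exists (F a). split; [|lra]. exists a. split; [lra|reflexivity].
  - exists (F b). split; [|lra]. exists b. split; [lra|reflexivity].
  - intros; lra.
Qed.

Lemma arc_continuum {T : Type} (d : T -> T -> R) (A : T -> Prop) :
  is_metric d -> arc d A -> continuum d A.
Proof.
  intros Hd (h & k & Hh & Hk & _ & Hc & _).
  assert (E : A = image h (fun t => 0 <= t <= 1)).
  { apply functional_extensionality. intros x. apply propositional_extensionality.
    split.
    - intros Ax. exists (k x). now apply Hk.
    - intros (t & Ht & <-). now apply Hh. }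
  rewrite E. apply (continuum_image Rdist); try apply continuum_interval; try lra.
  - apply Rdist_metric.
  - intros t Ht eps He. destruct (Hc t Ht eps He) as (e & He' & H).
    exists e. split; [assumption|]. intros s Hs Hd'. apply H; [assumption|].
    now rewrite Rabs_minus_sym.
Qed.

(** * Arcs of the circle *)

Definition px (p : S1) : R := fst (proj1_sig p).
Definition py (p : S1) : R := snd (proj1_sig p).

Lemma S1_eq (p q : S1) : px p = px q -> py p = py q -> p = q.
Proof.
  destruct p as [[a b] H], q as [[a' b'] H']. unfold px, py. simpl.
  intros -> ->. f_equal. apply proof_irrelevance.
Qed.

Lemma S1_norm (p : S1) : px p * px p + py p * py p = 1.
Proof. exact (proj2_sig p). Qed.

Lemma dS1_sqr (p q : S1) :
  dS1 p q * dS1 p q = (px p - px q) ^ 2 + (py p - py q) ^ 2.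
Proof. apply sqrt_sqrt. apply Rplus_le_le_0_compat; apply pow2_ge_0. Qed.

Lemma dS1_nonneg (p q : S1) : 0 <= dS1 p q.
Proof. apply sqrt_pos. Qed.

Lemma dS1_metric : is_metric dS1.
Proof.
  split; [|split; [|split]].
  - apply dS1_nonneg.
  - intros p q. pose proof (dS1_sqr p q) as E. split.
    + intros H. rewrite H in E.
      assert (E' : Rsqr (px p - px q) + Rsqr (py p - py q) = 0)
        by (unfold Rsqr; lra).
      destruct (Rplus_sqr_eq_0 _ _ E'). apply S1_eq; lra.
    + intros ->. apply Rsqr_0_uniq. unfold Rsqr. rewrite E. ring.
  - intros p q. unfold dS1. f_equal. ring.
  - intros p q r.
    assert (E : forall p q, dS1 p q = dist_euc (px p) (py p) (px q) (py q)).
    { intros. unfold dS1, dist_euc, px, py, Rsqr. f_equal. ring. }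
    rewrite !E. apply triangle.
Qed.

Definition antipode (p : S1) : S1.
Proof.
  exists (- px p, - py p). simpl. pose proof (S1_norm p). nra.
Defined.

(* Inverse stereographic projection from [antipode p], with [0] sent to [p]. *)
Definition chart (p : S1) (t : R) : S1.
Proof.
  exists ((px p * (1 - t * t) - py p * (2 * t)) / (1 + t * t),
          (py p * (1 - t * t) + px p * (2 * t)) / (1 + t * t)).
  simpl. pose proof (S1_norm p).
  apply (Rmult_eq_reg_r ((1 + t * t) * (1 + t * t))); [|nra].
  transitivity ((px p * px p + py p * py p) * ((1 + t * t) * (1 + t * t))).
  - field. nra.
  - rewrite H. ring.
Defined.

Lemma px_chart (p : S1) (t : R) :
  px (chart p t) = (px p * (1 - t * t) - py p * (2 * t)) / (1 + t * t).
Proof. reflexivity. Qed.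

Lemma py_chart (p : S1) (t : R) :
  py (chart p t) = (py p * (1 - t * t) + px p * (2 * t)) / (1 + t * t).
Proof. reflexivity. Qed.

Lemma chart_0 (p : S1) : chart p 0 = p.
Proof. apply S1_eq; rewrite ?px_chart, ?py_chart; field. Qed.

(** The chordal distance in stereographic coordinates, 2|s-t| / sqrt((1+s^2)(1+t^2)), squared and
    freed of denominators. It makes [chart p] Lipschitz, and its inverse Lipschitz on bounded
    intervals. *)
Lemma dS1_chart_sqr (p : S1) (s t : R) :
  dS1 (chart p s) (chart p t) * dS1 (chart p s) (chart p t)
  * ((1 + s * s) * (1 + t * t)) = 4 * ((s - t) * (s - t)).
Proof.
  rewrite dS1_sqr, !px_chart, !py_chart.
  transitivity ((px p * px p + py p * py p) * (4 * ((s - t) * (s - t)))).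
  - field. split; nra.
  - rewrite S1_norm. ring.
Qed.

Lemma dS1_chart_le (p : S1) (s t : R) :
  dS1 (chart p s) (chart p t) <= 2 * Rabs (s - t).
Proof.
  pose proof (dS1_chart_sqr p s t) as E.
  pose proof (dS1_nonneg (chart p s) (chart p t)) as H.
  pose proof (Rabs_pos (s - t)).
  pose proof (Rsqr_abs (s - t)) as A. unfold Rsqr in A. rewrite A in E.
  revert E H. generalize (dS1 (chart p s) (chart p t)). intros r E H.
  apply Rsqr_incr_0_var; [unfold Rsqr|lra].
  assert (1 <= (1 + s * s) * (1 + t * t)) by nra.
  nra.
Qed.

Lemma chart_coordinate_le (p : S1) (r s t : R) :
  - r <= s <= r -> - r <= t <= r ->
  Rabs (s - t) <= (1 + r * r) * dS1 (chart p s) (chart p t).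
Proof.
  intros Hs Ht. pose proof (dS1_chart_sqr p s t) as E.
  pose proof (dS1_nonneg (chart p s) (chart p t)) as H.
  pose proof (Rsqr_abs (s - t)) as A. unfold Rsqr in A. rewrite A in E.
  revert E H. generalize (dS1 (chart p s) (chart p t)). intros e E H.
  apply Rsqr_incr_0_var; [unfold Rsqr|nra].
  assert (s * s <= r * r) by nra. assert (t * t <= r * r) by nra.
  (* The exact formula gives the bound even with (1+r^2)/2; the factor 1/2 is given away. *)
  assert ((1 + s * s) * (1 + t * t) <= (1 + r * r) * (1 + r * r)) by nra.
  assert (e * e * ((1 + s * s) * (1 + t * t)) <=
    e * e * ((1 + r * r) * (1 + r * r))) by (apply Rmult_le_compat_l; nra).
  pose proof (Rle_0_sqr (Rabs (s - t))). unfold Rsqr in *. nra.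
Qed.

(* Up to a positive factor this is [(t - u) * (t - v)] at [chart p t], so the
   chord through [chart p u] and [chart p v] cuts out the arc between them. *)
Definition chord (p : S1) (u v : R) (x : S1) : R :=
  (1 + u * v) + ((u * v - 1) * px p + (u + v) * py p) * px x
  + ((u * v - 1) * py p - (u + v) * px p) * py x.

Lemma chord_chart (p : S1) (u v t : R) :
  chord p u v (chart p t) * (1 + t * t) = 2 * ((t - u) * (t - v)).
Proof.
  unfold chord. rewrite px_chart, py_chart.
  transitivity ((1 + u * v) * (1 + t * t) + (px p * px p + py p * py p) *
    ((u * v - 1) * (1 - t * t) - 2 * (u + v) * t)).
  - field. nra.
  - rewrite S1_norm. ring.
Qed.

Lemma chord_nonpos_chart (p : S1) (u v : R) (x : S1) :
  chord p u v x <= 0 -> exists t, x = chart p t.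
Proof.
  intros H. pose proof (S1_norm p) as Np. pose proof (S1_norm x) as Nx.
  unfold chord in H.
  (* [c] and [s] are the cosine and sine of the angle from [p] to [x]; the coordinate sought is the
     tangent of half that angle, s/(1+c). *)
  set (c := px p * px x + py p * py x).
  set (s := px p * py x - py p * px x).
  assert (Ncs : c * c + s * s = 1).
  { transitivity ((px p * px p + py p * py p) * (px x * px x + py x * py x)).
    - unfold c, s. ring.
    - rewrite Np, Nx. ring. }
  assert (Hc : 1 + c <> 0).
  (* c = -1 means that [x] is the pole of the projection, where the chord function takes the value
     2. *)
  { intros E. assert (c = -1) by lra. assert (s = 0) by nra.
    assert ((1 + u * v) + (u * v - 1) * c - (u + v) * s <= 0)
      by (unfold c, s; lra).
    rewrite H0, H1 in H2. lra. }
  assert (Et : 1 + s / (1 + c) * (s / (1 + c)) = 2 / (1 + c)).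
  { apply (Rmult_eq_reg_r ((1 + c) * (1 + c))); [|nra].
    transitivity ((1 + c) * (1 + c) + s * s); [field; assumption|].
    transitivity (2 * (1 + c)); [lra|field; assumption]. }
  assert (Ec : (1 - s / (1 + c) * (s / (1 + c))) / (2 / (1 + c)) = c).
  { replace (s / (1 + c) * (s / (1 + c))) with (2 / (1 + c) - 1) by lra.
    field. assumption. }
  assert (Es : 2 * (s / (1 + c)) / (2 / (1 + c)) = s) by (field; assumption).
  (* Both coordinates of [chart p] at s/(1+c) are instances of this rotation formula. *)
  assert (Hrot : forall a b, (a * (1 - s / (1 + c) * (s / (1 + c)))
    + b * (2 * (s / (1 + c)))) / (2 / (1 + c)) = a * c + b * s).
  { intros a b. revert Ec Es. generalize (s / (1 + c)), (2 / (1 + c)).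
    intros w z <- <-. unfold Rdiv. ring. }
  exists (s / (1 + c)). apply S1_eq; rewrite ?px_chart, ?py_chart, Et.
  - transitivity (px p * c + - py p * s).
    + transitivity ((px p * px p + py p * py p) * px x);
        [rewrite Np; ring|unfold c, s; ring].
    + rewrite <- Hrot. f_equal. ring.
  - transitivity (py p * c + px p * s).
    + transitivity ((px p * px p + py p * py p) * py x);
        [rewrite Np; ring|unfold c, s; ring].
    + now rewrite <- Hrot.
Qed.

Lemma open_half_plane (a b c : R) :
  open dS1 (fun x => c + a * px x + b * py x < 0).
Proof.
  intros x Hx.
  (* The affine function is Lipschitz with constant |a| + |b|; the summand 1 keeps the divisor
     positive when both vanish. *)
  set (K := Rabs a + Rabs b + 1).
  pose proof (Rabs_pos a). pose proof (Rabs_pos b).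
  assert (HK : 0 < K) by (unfold K; lra).
  exists (- (c + a * px x + b * py x) / K). split.
  { apply Rdiv_lt_0_compat; lra. }
  intros y Hy. apply (Rmult_lt_compat_r K) in Hy; [|assumption].
  unfold Rdiv in Hy. rewrite Rmult_assoc, Rinv_l, Rmult_1_r in Hy by lra.
  pose proof (dS1_nonneg x y) as Hd. pose proof (dS1_sqr x y) as E.
  assert (Hx1 : Rabs (py x - py y) <= dS1 x y /\ Rabs (px x - px y) <= dS1 x y).
  { split; apply Rsqr_incr_0_var; try assumption; rewrite <- Rsqr_abs;
      unfold Rsqr; rewrite E.
    - pose proof (pow2_ge_0 (px x - px y)). lra.
    - pose proof (pow2_ge_0 (py x - py y)). lra. }
  destruct Hx1 as [H2 H1].
  assert (A1 : a * (px y - px x) <= Rabs a * dS1 x y).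
  { eapply Rle_trans; [apply Rle_abs|]. rewrite Rabs_mult.
    apply Rmult_le_compat_l; [assumption|]. now rewrite Rabs_minus_sym. }
  assert (A2 : b * (py y - py x) <= Rabs b * dS1 x y).
  { eapply Rle_trans; [apply Rle_abs|]. rewrite Rabs_mult.
    apply Rmult_le_compat_l; [assumption|]. now rewrite Rabs_minus_sym. }
  unfold K in Hy. nra.
Qed.

Lemma open_chord_neg (p : S1) (u v : R) :
  open dS1 (fun x => chord p u v x < 0).
Proof. apply open_half_plane. Qed.

Lemma open_chord_pos (p : S1) (u v : R) :
  open dS1 (fun x => 0 < chord p u v x).
Proof.
  intros x Hx.
  destruct (open_half_plane (- ((u * v - 1) * px p + (u + v) * py p))
    (- ((u * v - 1) * py p - (u + v) * px p)) (- (1 + u * v)) x) as (r & Hr & H).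
  - unfold chord in Hx. lra.
  - exists r. split; [assumption|]. intros y Hy. specialize (H y Hy).
    unfold chord. cbv beta in H. lra.
Qed.

Lemma chord_neg_chart (p : S1) (u v t : R) :
  u <= v -> (chord p u v (chart p t) < 0 <-> u < t < v).
Proof. intros Huv. pose proof (chord_chart p u v t). split; intros; nra. Qed.

Lemma chord_neg (p : S1) (u v : R) (x : S1) :
  u <= v -> chord p u v x < 0 -> exists t, u < t < v /\ x = chart p t.
Proof.
  intros Huv H. destruct (chord_nonpos_chart p u v x) as [t ->]; [lra|].
  exists t. split; [|reflexivity]. now apply chord_neg_chart in H.
Qed.

Lemma chord_nonpos (p : S1) (u v : R) (x : S1) :
  u <= v -> chord p u v x <= 0 -> exists t, u <= t <= v /\ x = chart p t.
Proof.
  intros Huv H. destruct (chord_nonpos_chart p u v x H) as [t ->].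
  exists t. split; [|reflexivity]. pose proof (chord_chart p u v t). nra.
Qed.

Lemma chord_zero (p : S1) (u v : R) (x : S1) :
  chord p u v x = 0 -> x = chart p u \/ x = chart p v.
Proof.
  intros H. destruct (chord_nonpos_chart p u v x) as [t ->]; [lra|].
  pose proof (chord_chart p u v t) as E. rewrite H in E.
  assert (E' : (t - u) * (t - v) = 0) by lra.
  apply Rmult_integral in E'.
  destruct E'; [left|right]; f_equal; lra.
Qed.

(** The image of an open coordinate interval is the trace of an open half plane, hence open in the
    circle, and it contains the image of the midpoint. *)
Lemma dense_meets_chart_interval (D : S1 -> Prop) (p : S1) (u v : R) :
  dense dS1 D -> u < v -> exists t, u < t < v /\ D (chart p t).
Proof.
  intros HD Huv.
  destruct (open_chord_neg p u v (chart p ((u + v) / 2))) as (r & Hr & H).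
  { apply chord_neg_chart; lra. }
  destruct (HD (chart p ((u + v) / 2)) r Hr) as (y & Hy & Dy).
  apply H, chord_neg in Hy; [|lra]. destruct Hy as (t & Ht & ->).
  now exists t.
Qed.

Lemma chart_continuous (p : S1) (A : R -> Prop) :
  continuous_on Rdist dS1 (chart p) A.
Proof.
  intros s _ e He. exists (e / 2). split; [lra|]. intros t _ Ht.
  pose proof (dS1_chart_le p s t). unfold Rdist in Ht. lra.
Qed.

Lemma chart_inj (p : S1) (s t : R) : chart p s = chart p t -> s = t.
Proof.
  intros E. pose proof (dS1_chart_sqr p s t) as H.
  rewrite E, (dist_self dS1 dS1_metric) in H.
  assert (H' : (s - t) * (s - t) = 0) by lra.
  apply Rmult_integral in H'. lra.
Qed.

(** As [r] grows these arcs exhaust the circle without [antipode p]. *)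
Definition chart_arc (p : S1) (r : R) : S1 -> Prop :=
  image (chart p) (fun t => - r <= t <= r).

Lemma arc_chart_arc (p : S1) (r : R) : 0 < r -> arc dS1 (chart_arc p r).
Proof.
  intros Hr.
  (* Off the arc the coordinate defaults to 0, so that the choice yields a total function [k]. *)
  assert (Hin : forall x, exists t, chart_arc p r x -> - r <= t <= r /\ x = chart p t).
  { intros x. destruct (classic (chart_arc p r x)) as [(t & Ht & <-)|N].
    - now exists t.
    - exists 0. tauto. }
  set (k := fun x => proj1_sig (constructive_indefinite_description _ (Hin x))).
  assert (Hk : forall x, chart_arc p r x -> - r <= k x <= r /\ x = chart p (k x)).
  { intros x. unfold k. now destruct (constructive_indefinite_description _ (Hin x)). }
  exists (fun t => chart p (r * (2 * t - 1))), (fun x => (k x / r + 1) / 2).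
  assert (Hh : forall t, 0 <= t <= 1 -> chart_arc p r (chart p (r * (2 * t - 1)))).
  { intros t Ht. exists (r * (2 * t - 1)). split; [nra|reflexivity]. }
  assert (Ek : forall w, r * (2 * ((w / r + 1) / 2) - 1) = w)
    by (intros; field; lra).
  split; [assumption|]. split; [|split; [|split]].
  - intros x Hx. destruct (Hk x Hx) as [H1 H2]. rewrite Ek. split; [|now symmetry].
    pose proof (Ek (k x)). nra.
  - intros t Ht. destruct (Hk _ (Hh t Ht)) as [_ H2]. apply chart_inj in H2.
    rewrite <- H2. field. lra.
  (* The constant 4r combines the slope 2r of the reparametrization with the Lipschitz constant 2 of
     [chart]. *)
  - intros t _ e He. exists (e / (4 * r)).
    assert (He' : 0 < e / (4 * r)) by (apply Rdiv_lt_0_compat; lra).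
    split; [assumption|]. intros s _ Hs.
    eapply Rle_lt_trans; [apply dS1_chart_le|].
    replace (r * (2 * t - 1) - r * (2 * s - 1)) with ((2 * r) * (t - s)) by ring.
    rewrite Rabs_mult, (Rabs_right (2 * r)), Rabs_minus_sym by lra.
    apply (Rmult_lt_compat_l (4 * r)) in Hs; [|lra].
    replace (4 * r * (e / (4 * r))) with e in Hs by (field; lra). lra.
  (* [K] is the constant of [chart_coordinate_le] divided by the slope 2r. *)
  - intros x Hx e He. set (K := (1 + r * r) / (2 * r)).
    assert (HK : 0 < K) by (apply Rdiv_lt_0_compat; nra).
    exists (e / K). split; [now apply Rdiv_lt_0_compat|]. intros y Hy Hd.
    destruct (Hk x Hx) as [H1 H2]. destruct (Hk y Hy) as [H3 H4].
    pose proof (chart_coordinate_le p r (k x) (k y) H1 H3) as H5.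
    rewrite <- H2, <- H4 in H5.
    replace ((k x / r + 1) / 2 - (k y / r + 1) / 2) with
      (/ (2 * r) * (k x - k y)) by (field; lra).
    assert (Hi : 0 < / (2 * r)) by (apply Rinv_0_lt_compat; lra).
    rewrite Rabs_mult, (Rabs_right (/ (2 * r))) by lra.
    apply Rle_lt_trans with (K * dS1 x y).
    + unfold K. apply (Rmult_le_compat_l (/ (2 * r))) in H5; [|lra].
      unfold Rdiv. lra.
    + apply (Rmult_lt_compat_l K) in Hd; [|assumption].
      replace (K * (e / K)) with e in Hd by (field; lra). lra.
Qed.

Lemma chord_antipode (p : S1) (r : R) (x : S1) :
  chord (antipode p) (- r) r x
  = (1 - r * r) + (1 + r * r) * (px p * px x + py p * py x).
Proof.
  unfold chord. change (px (antipode p)) with (- px p).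
  change (py (antipode p)) with (- py p). ring.
 Qed.

(** Outside the arc the cosine c of the angle between [p] and [x] satisfies (1+r^2)c > r^2-1, so the
    squared distance 2-2c is below 4/(1+r^2). *)
Lemma outside_chart_arc_near (p : S1) (r : R) (x : S1) :
  0 < r -> ~ chart_arc (antipode p) r x -> dS1 p x < 2 / r.
Proof.
  intros Hr Hx.
  assert (H : 0 < chord (antipode p) (- r) r x).
  { apply Rnot_le_lt. intros C. apply Hx.
    apply chord_nonpos in C; [|lra]. destruct C as (t & Ht & ->). now exists t. }
  rewrite chord_antipode in H.
  pose proof (dS1_sqr p x) as E. pose proof (S1_norm p). pose proof (S1_norm x).
  set (c := px p * px x + py p * py x) in *.
  assert (E' : dS1 p x * dS1 p x = 2 - 2 * c) by (unfold c; nra).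
  assert (Hc : c <= 1) by nra.
  assert (Hr2 : 0 < 2 / r) by (apply Rdiv_lt_0_compat; lra).
  apply Rsqr_incrst_0; [unfold Rsqr; rewrite E'|apply dS1_nonneg|lra].
  apply (Rmult_lt_reg_l (r * r)); [nra|].
  replace (r * r * (2 / r * (2 / r))) with 4 by (field; lra).
  nra.
Qed.

Lemma chart_arc_not_in (p : S1) (r s : R) : r < s -> ~ chart_arc p r (chart p s).
Proof. intros Hs (t & Ht & E). apply chart_inj in E. lra. Qed.

(** For radius 1 the arcs are the two closed half circles bounded by the diameter orthogonal to [p];
    the sign of the scalar product decides. *)
Lemma chart_arc_antipode_1 (p x : S1) :
  chart_arc p 1 x \/ chart_arc (antipode p) 1 x.
Proof.
  destruct (Rle_lt_dec (px p * px x + py p * py x) 0) as [H|H].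
  - right. destruct (chord_nonpos (antipode p) (- (1)) 1 x) as (t & Ht & ->).
    + lra.
    + rewrite chord_antipode. nra.
    + now exists t.
  - left. destruct (chord_nonpos p (-1) 1 x) as (t & Ht & ->).
    + lra.
    + unfold chord. lra.
    + now exists t.
Qed.

Lemma continuum_chart_arc (p : S1) (r : R) :
  0 < r -> continuum dS1 (chart_arc p r).
Proof.
  intros Hr. apply arc_continuum; [apply dS1_metric|now apply arc_chart_arc].
Qed.

(** A common endpoint of the two half circles, at which [continuum_S1] glues them. *)
Lemma chart_1_antipode (p : S1) : chart p 1 = chart (antipode p) (-1).
Proof.
  apply S1_eq; rewrite ?px_chart, ?py_chart;
    change (px (antipode p)) with (- px p);
    change (py (antipode p)) with (- py p); field.
Qed.

Definition S1_base : S1.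
Proof. exists (1, 0). simpl. ring. Defined.

Lemma continuum_S1 : continuum dS1 (fun _ => True).
Proof.
  destruct (continuum_chart_arc S1_base 1) as (_ & K1 & C1); [lra|].
  destruct (continuum_chart_arc (antipode S1_base) 1) as (_ & K2 & C2); [lra|].
  assert (E : forall x : S1, True <->
    chart_arc S1_base 1 x \/ chart_arc (antipode S1_base) 1 x).
  { intros x. split; [intros _; apply chart_arc_antipode_1|trivial]. }
  split; [now exists S1_base|]. split.
  - now apply (compact_union _ _ _ _ K1 K2).
  - apply (connected_union dS1 _ _ _ (chart S1_base 1) C1 C2); [| |assumption].
    + exists 1. split; [lra|reflexivity].
    + exists (-1). split; [lra|]. symmetry. apply chart_1_antipode.
Qed.

Lemma closed_in_chart_arc (A : S1 -> Prop) (p : S1) :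
  closed dS1 A -> ~ A p ->
  exists r, 0 < r /\ subset A (chart_arc (antipode p) r).
Proof.
  intros HA Hp. destruct (HA p Hp) as (e & He & H).
  (* Points outside an arc of radius 2/e about the antipode are within 2/(2/e) = e of [p]. *)
  exists (2 / e). split; [apply Rdiv_lt_0_compat; lra|].
  intros x Ax. apply NNPP. intros C.
  apply outside_chart_arc_near in C; [|apply Rdiv_lt_0_compat; lra].
  replace (2 / (2 / e)) with e in C by (field; lra). now apply (H x).
Qed.

(** * The cycle of implications *)

Section StronglyIrreducible.
Context {T U : Type} (dT : T -> T -> R) (dU : U -> U -> R) (g : T -> U).
Context (HT : is_metric dT) (HU : is_metric dU).
Context (HK : compact dT (fun _ => True)) (Hg : continuous dT dU g).
Context (Hs : strongly_irreducible dT g).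

Lemma closed_image (A : T -> Prop) : closed dT A -> closed dU (image g A).
Proof.
  intros HA. apply compact_closed; [assumption|].
  apply (compact_image dT); [assumption| |].
  - intros x _ e He. destruct (Hg x e He) as (r & Hr & H). exists r. auto.
  - now apply closed_compact.
Qed.

(** The complement of the ball is a proper closed set, so its image misses some [g z]. That image is
    closed, hence misses a neighbourhood of [g z], and the fibres over this neighbourhood stay in
    the ball. *)
Lemma image_misses_open_set (x : T) (r : R) :
  0 < r -> exists z e, 0 < e /\
    forall w, dU (g z) (g w) < e -> forall v, g v = g w -> dT x v < r.
Proof.
  intros Hr. set (A := fun y => ~ dT x y < r).
  assert (HA : closed dT A) by (now apply closed_ball_complement).
  assert (HP : proper_subset A (fun _ => True)).
  { split; [now intros ? _|]. exists x. split; [trivial|].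
    intros C. apply C. now rewrite dist_self. }
  destruct (Hs A HA HP) as [_ (y & (z & _ & <-) & Hy)].
  destruct (closed_image A HA _ Hy) as (e & He & H).
  exists z, e. split; [assumption|]. intros w Hw v Hv. apply NNPP. intros C.
  apply (H (g w) Hw). now exists v.
Qed.

(** Continuity pulls the neighbourhood of [g z] back to a closed ball; at most half the radius is
    kept so that iterated balls shrink. *)
Lemma small_fibres_near (x : T) (r : R) :
  0 < r -> exists x' r', 0 < r' <= r / 2 /\
    forall w, dT x' w <= r' -> forall v, g v = g w -> dT x v < r.
Proof.
  intros Hr. destruct (image_misses_open_set x r Hr) as (z & e & He & H).
  destruct (Hg z e He) as (s & Hs0 & Hz). exists z, (Rmin (r / 2) (s / 2)).
  pose proof (Rmin_l (r / 2) (s / 2)). pose proof (Rmin_r (r / 2) (s / 2)).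
  split; [split; [apply Rmin_glb_lt; lra|assumption]|].
  intros w Hw. apply H, Hz. lra.
Qed.

(* Baire category: fibres through nested balls shrink to points. *)
Lemma strongly_irreducible_almost_injective : almost_injective dT g.
Proof.
  intros x0 r0 Hr0.
  set (B := {b : T * R | 0 < snd b}).
  set (step := fun b b' : B => snd (proj1_sig b') <= snd (proj1_sig b) / 2 /\
    forall w, dT (fst (proj1_sig b')) w <= snd (proj1_sig b') ->
    forall v, g v = g w -> dT (fst (proj1_sig b)) v < snd (proj1_sig b)).
  assert (Hstep : forall b, exists b', step b b').
  { intros [[x r] Hr]. destruct (small_fibres_near x r Hr) as (x' & r' & Hr' & H).
    exists (exist _ (x', r') (proj1 Hr')). split; [apply Hr'|exact H]. }
  set (next := fun b => proj1_sig (constructive_indefinite_description _ (Hstep b))).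
  assert (Hnext : forall b, step b (next b)).
  { intros b. unfold next. now destruct (constructive_indefinite_description _ (Hstep b)). }
  set (b := fun n => Nat.iter n next (exist _ (x0, r0) Hr0 : B)).
  set (c := fun n => fst (proj1_sig (b n))).
  set (r := fun n => snd (proj1_sig (b n))).
  assert (Hr : forall n, 0 < r n) by (intros n; exact (proj2_sig (b n))).
  assert (Hhalf : forall n, r (S n) <= r n / 2) by (intros n; apply (Hnext (b n))).
  assert (Hfib : forall n w, dT (c (S n)) w <= r (S n) ->
    forall v, g v = g w -> dT (c n) v < r n) by (intros n; apply (Hnext (b n))).
  assert (Hnest : forall m n x, (m <= n)%nat -> dT (c n) x <= r n -> dT (c m) x <= r m).
  { intros m n x Hmn. induction Hmn as [|n Hmn IH]; [trivial|].
    intros H. apply IH. left. now apply (Hfib n x). }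
  (* If the nested closed balls had no common point, their complements would exhaust the space, and
     one of these would contain the centre of its own ball. *)
  assert (Hz : exists z, forall n, dT (c n) z <= r n).
  { apply NNPP. intros C.
    destruct (compact_exhausted dT (fun _ => True) (fun n x => r n < dT (c n) x)
      HK) as [n Hn].
    - intros n. now apply open_dist_gt.
    - intros m n x Hmn H. apply Rnot_le_lt. intros D.
      apply (Hnest m) in D; [lra|assumption].
    - intros x _. apply NNPP. intros D. apply C. exists x. intros n.
      apply Rnot_lt_le. intros D'. apply D. now exists n.
    - specialize (Hn (c n) Logic.I). cbv beta in Hn. rewrite dist_self in Hn by assumption.
      specialize (Hr n). lra. }
  destruct Hz as [z Hz]. exists z. split.
  - exact (Hfib O z (Hz 1%nat) z eq_refl).
  - intros v Hv. apply NNPP. intros Hne.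
    assert (Hpos : 0 < dT z v) by (apply dist_pos; [assumption|congruence]).
    assert (Hlt : forall n, dT z v < 2 * r n).
    { intros n. pose proof (Hfib n z (Hz (S n)) v Hv).
      pose proof (dist_triangle dT HT z (c n) v).
      rewrite (dist_sym dT HT z (c n)) in *. pose proof (Hz n). lra. }
    (* Halving the radii gives at least harmonic decay, which already suffices for the Archimedean
       property. *)
    assert (Hsmall : forall n, r n * INR (S n) <= r 0%nat).
    { induction n as [|n IH]; [simpl; lra|]. rewrite S_INR in *.
      pose proof (Hhalf n). pose proof (Hr n). pose proof (pos_INR n).
      rewrite S_INR. nra. }
    destruct (INR_archimed (dT z v) (2 * r 0%nat) Hpos) as [n Hn].
    pose proof (Hsmall n). pose proof (Hlt n). rewrite S_INR in *.
    pose proof (pos_INR n). nra.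
Qed.

(** Every ball contains all fibres over some nonempty open set of values, and [D] meets that open
    set. *)
Lemma preimage_dense (D : U -> Prop) :
  (forall y, exists x, g x = y) -> dense dU D -> dense dT (preimage g D).
Proof.
  intros Hsurj HD x r Hr.
  destruct (image_misses_open_set x r Hr) as (z & e & He & H).
  destruct (HD (g z) e He) as (y & Hy & Dy). destruct (Hsurj y) as [w <-].
  exists w. split; [now apply (H w)|exact Dy].
Qed.

End StronglyIrreducible.

(** Near a point [p] of [B] outside [A] a coordinate interval misses [A]. If no subinterval lay in
    [B], then [B] would omit a point on either side of [p], and the chord through these two would
    separate [p] from [A] within [B]. *)
Lemma subcontinuum_contains_interval (A B : S1 -> Prop) :
  continuum dS1 A -> continuum dS1 B -> proper_subset A B ->
  exists p u v, u < v /\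
    forall t, u < t < v -> B (chart p t) /\ ~ A (chart p t).
Proof.
  intros ((q & Aq) & KA & _) (_ & _ & CB) (HAB & p & Bp & Np).
  destruct (compact_closed dS1 dS1_metric A KA p Np) as (r & Hr & H).
  assert (HnA : forall t, - (r / 4) < t < r / 4 -> ~ A (chart p t)).
  { intros t Ht. apply H. rewrite <- (chart_0 p) at 1.
    pose proof (dS1_chart_le p 0 t).
    assert (Rabs (0 - t) < r / 4) by (apply Rabs_def1; lra). lra. }
  apply NNPP. intros C.
  assert (Hout : forall u v, - (r / 4) <= u -> v <= r / 4 -> u < v ->
    exists t, u < t < v /\ ~ B (chart p t)).
  { intros u v Hu Hv Huv. apply NNPP. intros D. apply C. exists p, u, v.
    split; [assumption|]. intros t Ht. split; [|apply HnA; lra].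
    apply NNPP. intros D'. apply D. now exists t. }
  destruct (Hout (- (r / 4)) 0) as (u & Hu & Nu); try lra.
  destruct (Hout 0 (r / 4)) as (v & Hv & Nv); try lra.
  apply CB. exists (fun x => chord p u v x < 0), (fun x => 0 < chord p u v x).
  split; [apply open_chord_neg|]. split; [apply open_chord_pos|].
  split; [|split; [|split]].
  - intros x Bx. destruct (Rtotal_order (chord p u v x) 0) as [|[E|]];
      [now left| |now right].
    exfalso. apply chord_zero in E. now destruct E as [-> | ->].
  - exists p. split; [assumption|]. rewrite <- (chart_0 p) at 2.
    apply chord_neg_chart; lra.
  - exists q. split; [now apply HAB|]. apply Rnot_le_lt. intros D.
    apply chord_nonpos in D; [|lra]. destruct D as (t & Ht & ->).
    apply (HnA t); [lra|assumption].
  - intros; lra.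
Qed.

Section Circle.
Context {X : Type} (g : S1 -> X).

Lemma image_proper (A B : S1 -> Prop) (x : S1) :
  subset A B -> B x -> ~ A x -> (forall y, g y = g x -> y = x) ->
  proper_subset (image g A) (image g B).
Proof.
  intros HAB Bx Nx Hx. split.
  - intros y (z & Az & <-). exists z. auto.
  - exists (g x). split; [now exists x|]. intros (z & Az & E).
    apply Nx. now rewrite <- (Hx z E).
Qed.

Lemma almost_injective_hereditarily_irreducible :
  almost_injective dS1 g -> hereditarily_irreducible dS1 g.
Proof.
  intros HD A B HA HB HAB.
  destruct (subcontinuum_contains_interval A B HA HB HAB)
    as (p & u & v & Huv & H).
  destruct (dense_meets_chart_interval _ p u v HD Huv) as (t & Ht & Dt).
  destruct (H t Ht). now apply (image_proper A B (chart p t) (proj1 HAB)).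
Qed.

Lemma hereditarily_irreducible_arcwise_increasing :
  hereditarily_irreducible dS1 g -> arcwise_increasing dS1 g.
Proof.
  intros H A B HA HB. apply H; apply arc_continuum; assumption || apply dS1_metric.
Qed.

Lemma hereditarily_irreducible_irreducible :
  hereditarily_irreducible dS1 g -> irreducible dS1 g.
Proof. intros H K HK. apply H; [assumption|apply continuum_S1]. Qed.

Lemma subset_proper_image (A B : S1 -> Prop) :
  subset A B -> proper_subset (image g B) (image g (fun _ => True)) ->
  proper_subset (image g A) (image g (fun _ => True)).
Proof.
  intros HAB (_ & y & (z & _ & <-) & Hy). split.
  - intros ? (x & _ & <-). now exists x.
  - exists (g z). split; [now exists z|]. intros (w & Aw & E). apply Hy.
    exists w. auto.
Qed.

Lemma arcwise_increasing_strongly_irreducible :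
  arcwise_increasing dS1 g -> strongly_irreducible dS1 g.
Proof.
  intros H A HA (_ & p & _ & Np).
  destruct (closed_in_chart_arc A p HA Np) as (r & Hr & HAr).
  apply (subset_proper_image A (chart_arc (antipode p) r) HAr).
  (* The circle is not an arc, so (a) is applied to a larger proper arc; doubling the radius
     provides one. *)
  destruct (H (chart_arc (antipode p) r) (chart_arc (antipode p) (2 * r)))
    as (_ & y & (z & _ & <-) & Hy).
  - now apply arc_chart_arc.
  - apply arc_chart_arc. lra.
  - split.
    + intros x (t & Ht & <-). exists t. split; [lra|reflexivity].
    + exists (chart (antipode p) (2 * r)). split.
      * exists (2 * r). split; [lra|reflexivity].
      * apply chart_arc_not_in. lra.
  - split.
    + intros ? (x & _ & <-). now exists x.
    + exists (g z). split; [now exists z|assumption].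
Qed.

Lemma irreducible_strongly_irreducible :
  irreducible dS1 g -> strongly_irreducible dS1 g.
Proof.
  intros H A HA (_ & p & _ & Np).
  destruct (closed_in_chart_arc A p HA Np) as (r & Hr & HAr).
  apply (subset_proper_image A (chart_arc (antipode p) r) HAr).
  apply H; [now apply continuum_chart_arc|]. split; [now intros ? _|].
  exists (chart (antipode p) (2 * r)). split; [trivial|].
  apply chart_arc_not_in. lra.
Qed.

End Circle.

(** * Zero-dimensional subsets of the circle *)

Lemma codense_zero_dimensional (Z : S1 -> Prop) :
  dense dS1 (fun x => ~ Z x) -> zero_dimensional dS1 Z.
Proof.
  intros HD x Zx r Hr.
  (* An arc about [x] whose endpoints both avoid [Z] has a relatively clopen trace on [Z]. *)
  destruct (dense_meets_chart_interval _ x (- (r / 2)) 0 HD) as (u & Hu & Nu); [lra|].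
  destruct (dense_meets_chart_interval _ x 0 (r / 2) HD) as (v & Hv & Nv); [lra|].
  exists (fun y => Z y /\ chord x u v y < 0). split; [|split; [|split]].
  - split; [assumption|]. rewrite <- (chart_0 x) at 2. apply chord_neg_chart; lra.
  - intros y [Zy Hy]. split; [assumption|].
    apply chord_neg in Hy; [|lra]. destruct Hy as (t & Ht & ->).
    rewrite <- (chart_0 x) at 1. pose proof (dS1_chart_le x 0 t).
    assert (Rabs (0 - t) < r / 2) by (apply Rabs_def1; lra). lra.
  - intros c [_ Hc]. destruct (open_chord_neg x u v c Hc) as (e & He & H).
    exists e. split; [assumption|]. intros y Zy Hy. split; [assumption|].
    now apply H.
  - intros b Zb Nb. destruct (open_chord_pos x u v b) as (e & He & H).
    + destruct (Rtotal_order (chord x u v b) 0) as [|[E|]]; [tauto| |assumption].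
      exfalso. apply chord_zero in E. now destruct E as [-> | ->].
    + exists e. split; [assumption|]. intros y Zy Hy [_ Hn].
      specialize (H y Hy). cbv beta in H. lra.
Qed.

(** A ball inside [Z] would contain a nondegenerate arc, which a small relatively clopen
    neighbourhood of one endpoint would disconnect. *)
Lemma zero_dimensional_codense (Z : S1 -> Prop) :
  zero_dimensional dS1 Z -> dense dS1 (fun x => ~ Z x).
Proof.
  intros HZ x r Hr. apply NNPP. intros N.
  assert (Hball : forall y, dS1 x y < r -> Z y).
  { intros y Hy. apply NNPP. intros C. apply N. now exists y. }
  set (t0 := r / 4).
  assert (HI : forall t, 0 <= t <= t0 -> Z (chart x t)).
  { intros t Ht. apply Hball. rewrite <- (chart_0 x) at 1.
    pose proof (dS1_chart_le x 0 t). rewrite Rabs_minus_sym, Rabs_right in * by lra.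
    unfold t0 in *. lra. }
  assert (Hne : 0 < dS1 x (chart x t0)).
  { apply dist_pos; [apply dS1_metric|]. rewrite <- (chart_0 x) at 1.
    intros E. apply chart_inj in E. unfold t0 in E. lra. }
  (* The radius is the distance to the other endpoint, so [C] excludes that endpoint. *)
  destruct (HZ x) with (r := dS1 x (chart x t0)) as (C & Cx & HC & Hcl1 & Hcl2);
    [apply Hball; now rewrite (dist_self dS1 dS1_metric)|assumption|].
  set (K := image (chart x) (fun t => 0 <= t <= t0)).
  assert (HK : connected dS1 K).
  { apply (connected_image Rdist dS1 Rdist_metric).
    - apply chart_continuous.
    - apply continuum_interval. unfold t0. lra. }
  assert (KZ : forall y, K y -> Z y) by (intros y (t & Ht & <-); auto).
  apply HK. exists (relative_interior dS1 Z C),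
    (relative_interior dS1 Z (fun y => ~ C y)).
  split; [apply open_relative_interior, dS1_metric|].
  split; [apply open_relative_interior, dS1_metric|].
  split; [|split; [|split]].
  - intros y Ky. destruct (classic (C y)) as [Cy|Ny].
    + left. exact (Hcl1 y Cy).
    + right. exact (Hcl2 y (KZ y Ky) Ny).
  - exists x. split; [|exact (Hcl1 x Cx)].
    exists 0. split; [unfold t0; lra|apply chart_0].
  - exists (chart x t0).
    assert (Kt : K (chart x t0)) by (exists t0; split; [unfold t0; lra|reflexivity]).
    split; [assumption|]. apply Hcl2; [now apply KZ|].
    intros Ct. apply HC in Ct. lra.
  - intros y Ky Uy Vy.
    apply (relative_interior_sub dS1 dS1_metric) in Uy; [|auto].
    apply (relative_interior_sub dS1 dS1_metric) in Vy; [|auto]. contradiction.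
Qed.

(** * Fibres over edges *)

(** Both functions start at [s] and take all values up to the smaller of [F p] and [G q]. Near a
    parameter where [F] is halfway there, [N] supplies [t], and [G] attains the value [F t] as
    well. *)
Lemma common_value_on_dense_set (F G : R -> R) (N : R -> Prop) (e s p q : R) :
  continuous_on Rdist Rdist F (fun t => 0 <= t <= e) ->
  continuous_on Rdist Rdist G (fun t => 0 <= t <= e) ->
  F 0 = s -> G 0 = s ->
  (forall u v, u < v -> exists t, u < t < v /\ N t) ->
  0 < p <= e -> 0 < q <= e -> s < F p -> s < G q ->
  exists t t', 0 < t <= e /\ 0 < t' <= e /\ N t /\ F t = G t'.
Proof.
  intros HF HG F0 G0 HN Hp Hq Fp Gq.
  assert (Hsub : forall (H : R -> R) x, x <= e ->
    continuous_on Rdist Rdist H (fun t => 0 <= t <= e) ->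
    continuous_on Rdist Rdist H (fun t => 0 <= t <= x)).
  { intros H x Hx HH t Ht r Hr. destruct (HH t) with (eps := r) as (dl & Hdl & H');
      [lra|assumption|]. exists dl. split; [assumption|].
    intros z Hz. apply H'. lra. }
  set (m := Rmin (F p) (G q)).
  assert (Hm : s < m) by (now apply Rmin_glb_lt).
  assert (HmF : m <= F p) by apply Rmin_l.
  assert (HmG : m <= G q) by apply Rmin_r.
  destruct (intermediate_value F 0 p ((s + m) / 2)) as (w & Hw & Fw);
    [lra|apply Hsub; [lra|assumption]|lra|].
  assert (Hw0 : w <> 0) by (intros ->; lra).
  assert (Hwp : w <> p) by (intros ->; lra).
  destruct (HF w) with (eps := (m - s) / 2) as (dl & Hdl & H); [lra|lra|].
  (* The window about [w] is clipped to the interval from 0 to [p]; on it [F] stays strictly between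
     [s] and [m]. *)
  destruct (HN (Rmax 0 (w - dl)) (Rmin p (w + dl))) as (t & [Ht1 Ht2] & Nt).
  { apply Rmax_lub_lt; apply Rmin_glb_lt; lra. }
  pose proof (Rmax_l 0 (w - dl)). pose proof (Rmax_r 0 (w - dl)).
  pose proof (Rmin_l p (w + dl)). pose proof (Rmin_r p (w + dl)).
  assert (Ft : s < F t < m).
  { assert (Hd : Rdist (F w) (F t) < (m - s) / 2).
    { apply H; [lra|]. unfold Rdist. apply Rabs_def1; lra. }
    unfold Rdist in Hd. apply Rabs_def2 in Hd. lra. }
  destruct (intermediate_value G 0 q (F t)) as (t' & Ht' & Gt);
    [lra|apply Hsub; [lra|assumption]|lra|].
  assert (t' <> 0) by (intros ->; lra).
  exists t, t'. repeat split; try assumption; lra.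
Qed.

Section Branches.
Context {X : Type} (d : X -> X -> R) (g : S1 -> X).
Context (Hg : continuous dS1 d g).

Definition injective_at (x : S1) : Prop := forall y, g y = g x -> y = x.

(** The constant 2 is the Lipschitz bound of [chart]; the last clause is [almost_injective] read in
    the parameter. *)
Definition branch (E : X -> Prop) (e : R) (y : X) (c : R -> S1) : Prop :=
  (forall s t, dS1 (c s) (c t) <= 2 * Rabs (s - t)) /\
  (forall t, 0 <= t <= e -> E (g (c t))) /\
  g (c 0) = y /\
  (forall u v, u < v -> exists t, u < t < v /\ injective_at (c t)).

Definition chart_on (E : X -> Prop) (k : X -> R) : Prop :=
  continuous_on d Rdist k E /\
  forall x y, E x -> E y -> k x = k y -> x = y.

(** Negation exchanges the two sides of a point of the edge, so the argument for values above also
    serves for values below. *)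
Lemma chart_on_opp (E : X -> Prop) (k : X -> R) :
  chart_on E k -> chart_on E (fun x => - k x).
Proof.
  intros [Hk Hi]. split.
  - intros x Ex eps He. destruct (Hk x Ex eps He) as (r & Hr & H).
    exists r. split; [assumption|]. intros y Ey Hy. specialize (H y Ey Hy).
    unfold Rdist in *. rewrite Rabs_minus_sym.
    now replace (- k y - - k x) with (k x - k y) by ring.
  - intros x y Ex Ey Exy. apply Hi; try assumption. lra.
Qed.

Lemma branch_continuous (E : X -> Prop) (k : X -> R) (e : R) (y : X) (c : R -> S1) :
  chart_on E k -> branch E e y c ->
  continuous_on Rdist Rdist (fun t => k (g (c t))) (fun t => 0 <= t <= e).
Proof.
  intros [Hk _] (Hc & HE & _) t Ht eps He.
  destruct (Hk _ (HE t Ht) eps He) as (r & Hr & H).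
  destruct (Hg (c t) r Hr) as (r' & Hr' & H').
  exists (r' / 2). split; [lra|]. intros s Hs Hts. apply H; [now apply HE|].
  apply H'. pose proof (Hc t s). unfold Rdist in Hts. lra.
Qed.

(** The branches would share a value at an injectivity point of the first, which forces them to meet
    in the circle. *)
Lemma branches_not_both_above (E : X -> Prop) (k : X -> R) (e : R) (y : X)
  (c c' : R -> S1) (p q : R) :
  chart_on E k -> branch E e y c -> branch E e y c' ->
  (forall t t', 0 < t <= e -> 0 < t' <= e -> c t <> c' t') ->
  0 < p <= e -> 0 < q <= e ->
  k y < k (g (c p)) -> k y < k (g (c' q)) -> False.
Proof.
  intros Hk Hc Hc' Hdis Hp Hq Fp Gq.
  destruct (common_value_on_dense_set (fun t => k (g (c t)))
    (fun t => k (g (c' t))) (fun t => injective_at (c t)) e (k y) p q)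
    as (t & t' & Ht & Ht' & Nt & Et); try assumption.
  - now apply (branch_continuous E k e y).
  - now apply (branch_continuous E k e y).
  - f_equal. apply Hc.
  - f_equal. apply Hc'.
  - apply Hc.
  - apply (Hdis t t' Ht Ht'). symmetry. apply Nt.
    symmetry. apply (proj2 Hk); [apply Hc; lra|apply Hc'; lra|assumption].
Qed.

(** The value at an injectivity point differs from [y], because [y] has the two preimages [a] and
    [b]. *)
Lemma branch_leaves (E : X -> Prop) (k : X -> R) (e : R) (y : X) (c : R -> S1)
  (a b : S1) :
  0 < e -> chart_on E k -> branch E e y c -> a <> b -> g a = y -> g b = y ->
  exists p, 0 < p <= e /\ (k y < k (g (c p)) \/ k (g (c p)) < k y).
Proof.
  intros He Hk (_ & HE & H0 & HN) Hab Ha Hb.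
  destruct (HN 0 e He) as (t & Ht & Nt). exists t. split; [lra|].
  destruct (Rtotal_order (k (g (c t))) (k y)) as [|[Et|]]; [now right| |now left].
  exfalso. apply Hab. assert (Ey : g (c t) = y).
  { apply (proj2 Hk); [apply HE; lra| |assumption]. rewrite <- H0. apply HE. lra. }
  transitivity (c t); [|symmetry]; apply Nt; congruence.
Qed.

(* Two of three branches at [y] leave it on the same side of the edge, hence
   share a non-degenerate interval of values. *)
Lemma no_three_branches (E : X -> Prop) (k : X -> R) (e : R) (y : X)
  (c1 c2 c3 : R -> S1) (a b : S1) :
  0 < e -> chart_on E k ->
  branch E e y c1 -> branch E e y c2 -> branch E e y c3 ->
  (forall t t', 0 < t <= e -> 0 < t' <= e -> c1 t <> c2 t') ->
  (forall t t', 0 < t <= e -> 0 < t' <= e -> c1 t <> c3 t') ->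
  (forall t t', 0 < t <= e -> 0 < t' <= e -> c2 t <> c3 t') ->
  a <> b -> g a = y -> g b = y -> False.
Proof.
  intros He Hk B1 B2 B3 D12 D13 D23 Hab Ha Hb.
  assert (Hbelow : forall c c' p q, branch E e y c -> branch E e y c' ->
    (forall t t', 0 < t <= e -> 0 < t' <= e -> c t <> c' t') ->
    0 < p <= e -> 0 < q <= e ->
    k (g (c p)) < k y -> k (g (c' q)) < k y -> False).
  { intros c c' p q Bc Bc' Dc Hp Hq Fp Gq.
    apply (branches_not_both_above E (fun x => - k x) e y c c' p q);
      try assumption; [now apply chart_on_opp|lra|lra]. }
  pose proof (branches_not_both_above E k e y) as Habove.
  (* Pigeonhole: in each of the eight sign patterns two branches agree. *)
  destruct (branch_leaves E k e y c1 a b) as (p1 & H1 & [L1|L1]); try assumption;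
  destruct (branch_leaves E k e y c2 a b) as (p2 & H2 & [L2|L2]); try assumption;
  destruct (branch_leaves E k e y c3 a b) as (p3 & H3 & [L3|L3]); try assumption;
  solve [ apply (Habove c1 c2 p1 p2); assumption
        | apply (Habove c1 c3 p1 p3); assumption
        | apply (Habove c2 c3 p2 p3); assumption
        | apply (Hbelow c1 c2 p1 p2); assumption
        | apply (Hbelow c1 c3 p1 p3); assumption
        | apply (Hbelow c2 c3 p2 p3); assumption ].
Qed.

Lemma singleton_fibre_on_edge (E : X -> Prop) (k : X -> R) (a b : S1) :
  almost_injective dS1 g -> open d E -> chart_on E k -> E (g a) ->
  g a = g b -> a = b.
Proof.
  intros HD HE Hk Ea Hab. apply NNPP. intros Hne.
  assert (Hloc : forall z, E (g z) -> exists r, 0 < r /\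
    forall w, dS1 z w < r -> E (g w)).
  { intros z Ez. destruct (HE _ Ez) as (r & Hr & H).
    destruct (Hg z r Hr) as (r' & Hr' & H'). exists r'. auto. }
  destruct (Hloc a Ea) as (ra & Hra & Ha).
  destruct (Hloc b) as (rb & Hrb & Hb); [congruence|].
  assert (Hpos : 0 < dS1 a b) by (apply dist_pos; [apply dS1_metric|assumption]).
  (* Coordinates up to [e] move a point by at most 2e. Fifths keep the arcs about [a] and [b]
     disjoint, since 4e is less than their distance; quarters keep both arcs over [E]. *)
  set (e := Rmin (dS1 a b / 5) (Rmin (ra / 4) (rb / 4))).
  assert (He : 0 < e) by (repeat apply Rmin_glb_lt; lra).
  assert (He1 : e <= dS1 a b / 5) by apply Rmin_l.
  assert (He2 : e <= ra / 4)
    by (eapply Rle_trans; [apply Rmin_r|apply Rmin_l]).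
  assert (He3 : e <= rb / 4)
    by (eapply Rle_trans; [apply Rmin_r|apply Rmin_r]).
  assert (Hnear : forall z t, - e <= t <= e -> dS1 z (chart z t) <= 2 * e).
  { intros z t Ht. rewrite <- (chart_0 z) at 1. pose proof (dS1_chart_le z 0 t).
    assert (Rabs (0 - t) <= e) by (apply Rabs_le; lra). lra. }
  assert (Hfar : forall t t', - e <= t <= e -> - e <= t' <= e ->
    chart a t <> chart b t').
  { intros t t' Ht Ht' Et. pose proof (Hnear a t Ht) as N1.
    pose proof (Hnear b t' Ht') as N2.
    pose proof (dist_triangle dS1 dS1_metric a (chart a t) b) as N3.
    rewrite (dist_sym dS1 dS1_metric (chart a t) b) in N3. rewrite <- Et in N2. lra. }
  assert (Hinj : forall z u v, u < v ->
    exists t, u < t < v /\ injective_at (chart z t)).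
  { intros z u v Huv. exact (dense_meets_chart_interval _ z u v HD Huv). }
  (* The branches are the backward and forward half-arcs at [a] and the forward one at [b]. *)
  apply (no_three_branches E k e (g a) (fun t => chart a (- t))
    (fun t => chart a t) (fun t => chart b t) a b); try assumption; try easy.
  - split; [|split; [|split]].
    + intros s t. rewrite (Rabs_minus_sym s t).
      replace (t - s) with (- s - - t) by ring. apply dS1_chart_le.
    + intros t Ht. apply Ha. pose proof (Hnear a (- t)). lra.
    + now rewrite Ropp_0, chart_0.
    + intros u v Huv. destruct (Hinj a (- v) (- u)) as (t & Ht & It); [lra|].
      exists (- t). rewrite Ropp_involutive. split; [lra|assumption].
  - split; [|split; [|split]].
    + apply dS1_chart_le.
    + intros t Ht. apply Ha. pose proof (Hnear a t). lra.
    + now rewrite chart_0.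
    + apply Hinj.
  - split; [|split; [|split]].
    + apply dS1_chart_le.
    + intros t Ht. apply Hb. pose proof (Hnear b t). lra.
    + now rewrite chart_0.
    + apply Hinj.
  - intros t t' Ht Ht' Et. apply chart_inj in Et. lra.
  - intros t t' Ht Ht'. apply Hfar; lra.
  - intros t t' Ht Ht'. apply Hfar; lra.
Qed.

End Branches.

(** * Assembly of the implications into the equivalences *)

Theorem theorem2p3 (X : Type) (d : X -> X -> R) (Hd : is_metric d)
  (HX : peano_continuum d) (g : S1 -> X) (Hg : continuous dS1 d g)
  (Hsurj : forall y, exists z, g z = y) :
  (arcwise_increasing dS1 g <-> hereditarily_irreducible dS1 g) /\
  (hereditarily_irreducible dS1 g <-> strongly_irreducible dS1 g) /\
  (strongly_irreducible dS1 g <-> almost_injective dS1 g) /\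
  (almost_injective dS1 g <-> irreducible dS1 g) /\
  (peano_graph d ->
     (irreducible dS1 g <->
        edgewise_eulerian d g /\ zero_dimensional dS1 (preimage g (Gr d)))).
Proof.
  assert (ac : arcwise_increasing dS1 g -> strongly_irreducible dS1 g)
    by apply arcwise_increasing_strongly_irreducible.
  assert (cd : strongly_irreducible dS1 g -> almost_injective dS1 g).
  { apply (strongly_irreducible_almost_injective dS1 d); try assumption.
    - apply dS1_metric.
    - apply continuum_S1. }
  assert (db : almost_injective dS1 g -> hereditarily_irreducible dS1 g)
    by apply almost_injective_hereditarily_irreducible.
  assert (ba : hereditarily_irreducible dS1 g -> arcwise_increasing dS1 g)
    by apply hereditarily_irreducible_arcwise_increasing.
  assert (be : hereditarily_irreducible dS1 g -> irreducible dS1 g)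
    by apply hereditarily_irreducible_irreducible.
  assert (ec : irreducible dS1 g -> strongly_irreducible dS1 g)
    by apply irreducible_strongly_irreducible.
  (* The cycle (a), (c), (d), (b), (a) and the detour from (b) through (e) to (c) link all five
     conditions. *)
  do 4 (split; [tauto|]).
  intros [_ Hgraph]. split.
  - intros He. split; [split; [exact Hsurj|]|].
    + intros y (E & (HE & (h & k & _ & Hhk & _ & _ & Hk) & _) & Ey).
      destruct (Hsurj y) as [a Ha]. exists a. intros b. split; [|congruence].
      intros Hb. symmetry.
      apply (singleton_fibre_on_edge d g Hg E k); [tauto|exact HE| |congruence..].
      split; [exact Hk|]. intros x z Ex Ez Exz.
      destruct (Hhk x Ex) as [_ <-]. destruct (Hhk z Ez) as [_ <-]. congruence.
    (* Points over edges avoid the preimage of [Gr] and are dense by [preimage_dense]. *)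
    + apply codense_zero_dimensional. intros x r Hr.
      destruct (preimage_dense dS1 d g dS1_metric Hd (proj1 (proj2 continuum_S1))
        Hg (ec He) (in_edge d) Hsurj Hgraph x r Hr) as (z & Hz & Iz).
      exists z. split; [assumption|]. intros N. exact (N Iz).
  - intros [[_ Hedge] Hzero]. apply be, db. intros x r Hr.
    (* Points off the preimage of [Gr] lie over edges, where fibres are singletons; their density is
       (d). *)
    destruct (zero_dimensional_codense _ Hzero x r Hr) as (z & Hz & Nz).
    exists z. split; [assumption|]. intros w Hw.
    destruct (Hedge (g z)) as (z0 & Hz0); [now apply NNPP|].
    transitivity z0; [|symmetry]; now apply Hz0.
Qed.
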